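(* A position $(a,b)$ with $a\le b$ is a $\mathcal{P}$-position in mis\`ere $\mathcal{F}$-Wythoff if and only if it is an element of the set $$\{(0,1)\}\cup\{(\lfloor \phi n \rfloor+2,\ \lfloor \phi^2 n \rfloor +2) \mid n \in \mathbb{Z},\ n\geq 0 \}.$$
   Context: $\phi = (1+\sqrt5)/2$ and $\lfloor\cdot\rfloor$ is the integer part. A position is an unordered pair $(a,b)$ of nonnegative integers (two piles of tokens); $(a,b)$ is identified with $(b,a)$. $\mathcal{F}$-Wythoff is the impartial two-player game with the following legal moves: (i) remove any positive number of tokens from one pile; (ii) remove the same positive number $k$ of tokens from both piles, provided the integer ratio of the two entries does not change, i.e. from $(a,b)$ with $1\le a\le b$ one may move to $(a-k,b-k)$ with $1\le k<a$ if $\lfloor (b-k)/(a-k)\rfloor=\lfloor b/a\rfloor$. Players alternate moves. In mis\`ere $\mathcal{F}$-Wythoff the moves are the same, but the player who makes the last move loses (so a player about to move at $(0,0)$ wins). A $\mathcal{P}$-position is a position from which the player about to move has no winning strategy. *)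

(* Defs.v *)
From HB Require Import structures.
From mathcomp Require Import all_boot all_order all_algebra.
From mathcomp Require Import all_classical reals.

Set Implicit Arguments.
Unset Strict Implicit.
Unset Printing Implicit Defensive.

Import Order.TTheory GRing.Theory Num.Theory.

Definition golden_ratio (R : realType) : R := ((1 + Num.sqrt 5) / 2)%R.

(** Unordered pairs of naturals are encoded by their sorted representative;
    [pos a b] is the unordered pair, so that [pos a b = pos b a]. *)
Record position := Position {
  small_pile : nat;
  large_pile : nat;
  small_le_large : small_pile <= large_pile
}.

Lemma minn_le_maxn (a b : nat) : minn a b <= maxn a b.
Proof. by rewrite geq_min leq_maxl. Qed.

Definition pos (a b : nat) : position := Position (minn_le_maxn a b).

Lemma posC (a b : nat) : pos a b = pos b a.
Proof.
rewrite /pos; move: (minn_le_maxn a b) (minn_le_maxn b a).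
by rewrite minnC maxnC => p q; rewrite (bool_irrelevance p q).
Qed.

(** [move_one] covers removal from either pile, by [posC].  In [move_both],
    [%/] is the floor of the ratio; both divisors are positive. *)
Inductive move : position -> position -> Prop :=
| move_one (a b k : nat) :
    1 <= k <= a -> move (pos a b) (pos (a - k) b)
| move_both (a b k : nat) :
    1 <= a <= b -> 1 <= k < a -> (b - k) %/ (a - k) = b %/ a ->
    move (pos a b) (pos (a - k) (b - k)).

Definition terminal (p : position) : Prop := forall q, ~ move p q.

(** The list [s] contains the positions reached after [p], in order. *)
Fixpoint play (p : position) (s : seq position) : Prop :=
  if s is q :: s' then move p q /\ play q s' else True.

(** A strategy for the player about to move at the initial position [p] maps
    the play [s] so far (the initial position being left out) to the next
    position.  That player is to move exactly when [size s] is even. *)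
Definition strategy := seq position -> position.

Definition follows (sigma : strategy) (s : seq position) : Prop :=
  forall s1 q s2, s = s1 ++ q :: s2 -> ~~ odd (size s1) -> q = sigma s1.

Definition legal_strategy (p : position) (sigma : strategy) : Prop :=
  forall s, play p s -> follows sigma s -> ~~ odd (size s) ->
    ~ terminal (last p s) -> move (last p s) (sigma s).

(** A completed play from [p] is won by the player who did not make the last
    move; for the player about to move at [p] this means that the number of
    moves is even (possibly zero).  There are no infinite plays, since each
    move decreases the number of tokens. *)
Definition misere_winning_strategy (p : position) (sigma : strategy) : Prop :=
  legal_strategy p sigma /\
  forall s, play p s -> follows sigma s -> terminal (last p s) ->
    ~~ odd (size s).

Definition misere_P_position (p : position) : Prop :=
  ~ exists sigma : strategy, misere_winning_strategy p sigma.

(* Main.v *)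
(** Write A_n = floor(phi n), so that floor(phi^2 n) = A_n + n.  By Beatty's
    theorem, every integer k >= 2 is an entry of exactly one pair
    (A_n + 2, A_n + n + 2), and the difference n determines the pair.  Hence no
    move joins two pairs of the set.  Conversely, from (a, b) outside the set
    with 2 <= a = A_n + 2 <= b < a + n, taking tokens from both piles leads to
    the pair of difference b - a, and both integer ratios are 1; the other
    cases only need tokens of one pile. *)

Require Import Defs.
From HB Require Import structures.
From mathcomp Require Import all_boot all_order all_algebra.
From mathcomp Require Import all_classical reals.
From mathcomp Require Import zify ring lra.

Set Implicit Arguments.
Unset Strict Implicit.
Unset Printing Implicit Defensive.

Import Order.TTheory GRing.Theory Num.Theory.

(** * Token counts and one-move extensions of plays *)

Definition tokens (p : position) : nat := small_pile p + large_pile p.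

Lemma tokens_pos (a b : nat) : tokens (pos a b) = a + b.
Proof. by rewrite /tokens /pos /=; lia. Qed.

Lemma pos_sorted (p : position) : p = pos (small_pile p) (large_pile p).
Proof.
case: p => a b hab; rewrite /pos /=.
move: (minn_le_maxn a b); rewrite (minn_idPl hab) (maxn_idPr hab) => h.
by rewrite (bool_irrelevance h hab).
Qed.

Lemma move_tokens (p q : position) : move p q -> tokens q < tokens p.
Proof. by case=> a b k *; rewrite !tokens_pos; lia. Qed.

Lemma play_rcons (p q : position) (s : seq position) :
  play p (rcons s q) <-> play p s /\ move (last p s) q.
Proof.
elim: s p => [|r s IHs] p /=; first by tauto.
by rewrite IHs; tauto.
Qed.

Lemma follows_rcons (sigma : strategy) (q : position) (s : seq position) :
  follows sigma (rcons s q) <->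
  follows sigma s /\ (~~ odd (size s) -> q = sigma s).
Proof.
split=> [h | [h hq]].
  split; last by apply: (h _ _ [::]); rewrite cats1.
  by move=> s1 r s2 es; apply: (h _ _ (rcons s2 q)); rewrite es rcons_cat.
move=> s1 r s2; case: (lastP s2) => [|s3 t].
  by rewrite cats1 => /rcons_inj[<- <-].
rewrite -rcons_cons -rcons_cat => /rcons_inj[es _].
exact: h es.
Qed.

(** * Misère P-positions as a kernel of the move graph *)

Section Kernel.

Variable K : position -> Prop.
Hypothesis K_nonterminal : forall p, K p -> ~ terminal p.
Hypothesis K_stable : forall p q, K p -> move p q -> ~ K q.
Hypothesis K_absorbing :
  forall p, ~ K p -> ~ terminal p -> exists2 q, move p q & K q.

(** The opponent answers each move of [sigma] by returning to [K]. Every round lowers [tokens], so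
    induction on that number gives the contradiction. *)
Lemma kernel_no_winning_strategy (p : position) (sigma : strategy) :
  K p -> ~ misere_winning_strategy p sigma.
Proof.
move=> Kp [legal win].
suff loses n s : tokens (last p s) < n -> play p s -> follows sigma s ->
    ~~ odd (size s) -> ~ K (last p s).
  by apply: (loses (tokens p).+1 [::]) => // s1 q s2; case: s1.
elim: n s => // n IHn s lt_n plays fol even_s Kl.
have mv := legal s plays fol even_s (K_nonterminal Kl).
have plays1 : play p (rcons s (sigma s)) by apply/play_rcons.
have fol1 : follows sigma (rcons s (sigma s)) by apply/follows_rcons.
have odd1 : odd (size (rcons s (sigma s))) by rewrite size_rcons /= even_s.
have [|q mvq Kq] := K_absorbing (K_stable Kl mv).
  (* A terminal position here would end the play after an odd number of moves, against [win]. *)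
  move=> ter; have := win _ plays1 fol1.
  by rewrite last_rcons odd1 => /(_ ter).
apply: (IHn (rcons (rcons s (sigma s)) q)); last by rewrite last_rcons.
- have := move_tokens mvq; have := move_tokens mv; rewrite last_rcons.
  by move: lt_n; lia.
- by apply/play_rcons; split=> //; rewrite last_rcons.
- by apply/follows_rcons; split=> //; rewrite odd1.
- by rewrite size_rcons /= odd1.
Qed.

(** A positional strategy that enters [K] whenever possible meets [K] exactly after odd numbers of
    moves, and no terminal position lies in [K]. *)
Lemma nonkernel_winning_strategy (p : position) :
  ~ K p -> exists sigma, misere_winning_strategy p sigma.
Proof.
move=> nKp.
(* Legality is secured at every nonterminal [r], even in [K], so that [legal_strategy] holds along
   any play; a terminal [r] gets itself as default. *)
have step r : exists q, (~ terminal r -> move r q) /\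
    (~ terminal r -> ~ K r -> K q).
  have [ter|nter] := pselect (terminal r); first by exists r.
  have [Kr|nKr] := pselect (K r).
    by have /existsNP[q /contrapT mv] := nter; exists q.
  by have [q mv Kq] := K_absorbing nKr nter; exists q.
have [f fP] := choice step.
exists (fun s => f (last p s)); split=> [s _ _ _|s plays fol ter].
  by case: (fP (last p s)).
suff alternates t : play p t -> follows (fun s => f (last p s)) t ->
    (K (last p t) <-> odd (size t)).
  by apply/negP => /(alternates s plays fol)/K_nonterminal.
elim/last_ind: t => [|t q IHt]; first by [].
move=> /play_rcons[plt mv] /follows_rcons[flt qE].
have {}IHt := IHt plt flt.
rewrite last_rcons size_rcons /=.
case: (boolP (odd (size t))) IHt qE => [_ [_ /(_ isT) Kt] _|_ [nKt _] ->//] /=.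
  by split=> // /(K_stable Kt mv).
split=> // _; have [_] := fP (last p t); apply=> [ter'|/nKt//].
exact: ter' mv.
Qed.

Lemma misere_P_position_kernel (p : position) : misere_P_position p <-> K p.
Proof.
split=> [nwin | Kp [sigma]]; last exact: kernel_no_winning_strategy.
by apply: contrapT => /nonkernel_winning_strategy.
Qed.

End Kernel.

(** * Irrationality of the golden ratio and its Beatty sequences *)

(** Infinite descent: a solution [(k, n)] satisfies [n < k < 2n] and yields the smaller solution
    [(n, k - n)]. *)
Lemma golden_norm_neq0 (k n : nat) : 0 < n -> k * k <> k * n + n * n.
Proof.
elim/ltn_ind: n k => n IHn k n_gt0 e.
have lt_nk : n < k by nia.
have lt_kn : k < n + n by nia.
by apply: (IHn (k - n) _ n); nia.
Qed.

Section Beatty.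

Variable R : realType.
Local Open Scope ring_scope.

Local Notation phi := (golden_ratio R).

Lemma golden_ratio_sqr : phi ^+ 2 = phi + 1.
Proof.
have := @sqr_sqrtr R 5 (ler0n _ 5); rewrite /golden_ratio.
by move: (Num.sqrt 5) => s hs; field: hs.
Qed.

Lemma golden_ratio_gt1 : 1 < phi.
Proof.
have := @ltr_sqrt R 1 5; rewrite sqrtr1 /golden_ratio => h.
have : 1 < Num.sqrt (5 : R) by rewrite h; lra.
lra.
Qed.

Lemma golden_ratio_irrational (k n : nat) :
  (0 < n)%N -> phi * n%:R <> k%:R.
Proof.
move=> n_gt0 e; apply: (@golden_norm_neq0 k n n_gt0).
apply: (mulrIn (oner_neq0 R)); rewrite natrD !natrM -e.
have := golden_ratio_sqr; move: phi => x hx.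
have -> : x * n%:R * (x * n%:R) = x ^+ 2 * n%:R ^+ 2 by ring.
by rewrite hx; ring.
Qed.

Definition wythoff (n : nat) : nat := Num.truncn (phi * n%:R).

Lemma wythoff_itv (n : nat) :
  (wythoff n)%:R <= phi * n%:R < (wythoff n)%:R + 1.
Proof.
rewrite natr1; apply: truncn_itv; apply: mulr_ge0 => //.
by have := golden_ratio_gt1; lra.
Qed.

Lemma wythoff_eq (n k : nat) :
  k%:R <= phi * n%:R < k%:R + 1 -> wythoff n = k.
Proof. by rewrite natr1 => h; apply: truncn_def. Qed.

Lemma floor_golden (n : nat) :
  Num.floor (phi * n%:R) = (wythoff n)%:Z.
Proof. by apply: floor_def; rewrite intrD; apply: wythoff_itv. Qed.

Lemma floor_golden_sqr (n : nat) :
  Num.floor (phi ^+ 2 * n%:R) = (wythoff n + n)%N%:Z.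
Proof.
apply: floor_def; rewrite golden_ratio_sqr intrD -!pmulrn natrD mulrDl mul1r.
by have := wythoff_itv n; lra.
Qed.

Lemma wythoff0 : wythoff 0 = 0%N.
Proof. by apply: wythoff_eq; rewrite mulr0; lra. Qed.

Lemma leq_wythoff (n : nat) : (n <= wythoff n)%N.
Proof.
rewrite -ltnS -(ltr_nat R) -natr1.
have := wythoff_itv n; have := golden_ratio_gt1; have := ler0n R n; nra.
Qed.

Lemma wythoff_mono (m n : nat) : (m < n)%N -> (wythoff m < wythoff n)%N.
Proof.
move=> lt_mn; rewrite -ltnS -(ltr_nat R) -[(wythoff n).+1%:R]natr1 -natr1.
have : m.+1%:R <= n%:R :> R by rewrite ler_nat.
rewrite -natr1.
have := wythoff_itv n; have := wythoff_itv m; have := golden_ratio_gt1; nra.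
Qed.

(** For a common value [k], multiplying the bounds on [phi n] by [phi] and adding those on [phi m]
    traps [(phi + 1)(n + m)] between [(phi + 1) k] and [(phi + 1)(k + 1)], so [k = n + m]. *)
Lemma wythoff_disjoint (m n : nat) :
  (0 < n)%N -> wythoff n <> (wythoff m + m)%N.
Proof.
move=> n_gt0 e; have := wythoff_itv n; have := wythoff_itv m.
have := golden_ratio_gt1; have := golden_ratio_sqr.
have := @golden_ratio_irrational (wythoff n) n n_gt0.
set k := wythoff n in e *.
have -> : (wythoff m)%:R = k%:R - m%:R :> R by rewrite e natrD addrK.
move: phi => x irr x2 x1 /andP[hm1 hm2] /andP[hn1 hn2].
have xx (y : R) : x * (x * y) = x * y + y by rewrite mulrA -expr2 x2; ring.
have x0 : 0 < x by lra.
have x10 : 0 < x + 1 by lra.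
move: (hn1) hn2; rewrite -(ler_pM2l x0) -(ltr_pM2l x0) xx => hn3 hn4.
have lb : k%:R <= (n + m)%:R :> R.
  by rewrite natrD -(ler_pM2l x10); lra.
have ub : (n + m)%:R < k.+1%:R :> R.
  by rewrite natrD -natr1 -(ltr_pM2l x10); lra.
move: lb ub; rewrite ler_nat ltr_nat => lb ub.
have ek : k%:R = n%:R + m%:R :> R by rewrite -natrD; congr _%:R; lia.
(* Now [phi m <= n <= phi m], and multiplying by [phi] gives [phi n <= n + m]; hence [phi n = k],
   which irrationality forbids. *)
rewrite ek in irr hm1 hn1 hn3.
have hm3 : x * n%:R <= x * (x * m%:R) by rewrite ler_pM2l //; lra.
by apply: irr; apply/le_anti/andP; split=> //; rewrite xx in hm3; lra.
Qed.

(* With n the integer part of (k + 1) / phi, either k = A_n or k = A_m + m for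
   m = k - n. *)
Lemma wythoff_cover (k : nat) :
  exists n, k = wythoff n \/ k = (wythoff n + n)%N.
Proof.
have x1 := golden_ratio_gt1; have x2 := golden_ratio_sqr.
have x0 : 0 < phi by lra.
pose n := Num.truncn (k.+1%:R / phi).
have : n%:R <= k.+1%:R / phi < n.+1%:R by apply: truncn_itv; rewrite divr_ge0 // ltW.
rewrite ler_pdivlMr // ltr_pdivrMr // -(natr1 n) => /andP[le_n lt_n].
have {le_n} lt_nk : phi * n%:R < k.+1%:R.
  rewrite mulrC lt_neqAle le_n andbT; apply/eqP => e.
  case: (posnP n) => [n0|n_gt0].
    by move: e; rewrite n0 mul0r => /eqP; rewrite eq_sym pnatr_eq0.
  by apply: (@golden_ratio_irrational k.+1 n n_gt0); rewrite mulrC.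
move: lt_nk lt_n; rewrite -(natr1 k) => lt_nk lt_n.
have [le_k|lt_k] := leP k%:R (phi * n%:R).
  by exists n; left; apply/esym/wythoff_eq; rewrite le_k.
have le_nk : (n <= k)%N.
  rewrite -(ler_nat R) (le_trans _ (ltW lt_k)) //.
  by apply: ler_peMl; [exact: ler0n|exact: ltW].
exists (k - n)%N; right.
suff -> : wythoff (k - n) = n by lia.
apply: wythoff_eq; rewrite natrB //.
have xx (y : R) : phi * (phi * y) = phi * y + y.
  by rewrite mulrA -expr2 x2; ring.
(* Multiplied by [phi], the bounds [phi n < k] and [k + 1 < phi (n + 1)] become
   [n < phi (k - n) < n + 1]. *)
rewrite -(ltr_pM2l x0) xx in lt_k.
rewrite mulrC -(ltr_pM2l x0) xx in lt_n.
by lra.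
Qed.

Definition wythoff_pair (a b : nat) : Prop :=
  (a = 0%N /\ b = 1%N) \/
  exists n, a = (wythoff n + 2)%N /\ b = (wythoff n + n + 2)%N.

End Beatty.

(** * The shifted Wythoff pairs form a kernel *)

Section Game.

Variable R : realType.

Local Notation A := (wythoff R).
Local Notation K := (wythoff_pair R).

Lemma wythoff_pair_share (a b a' b' : nat) : K a b -> K a' b' ->
  [\/ a = a', a = b', b = a' | b = b'] -> a = a' /\ b = b'.
Proof.
(* A coincidence of a lower with an upper entry occurs only at index 0, in the pair [(2, 2)]. *)
have disj m n : A n = A m + m -> m = n.
  move=> e; case: (posnP n) => [n0|]; last by move=> /wythoff_disjoint /(_ e).
  by move: e; rewrite n0 wythoff0; lia.
case=> [[-> ->]|[n [-> ->]]] [[-> ->]|[m [-> ->]]] share.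
- by [].
- by case: share; lia.
- by case: share; lia.
suff -> : n = m by [].
case: share => e.
- case: (ltngtP n m) => // /(@wythoff_mono R); lia.
- by apply/esym/disj; lia.
- by apply: disj; lia.
- case: (ltngtP n m) => // lt; have := wythoff_mono R lt; lia.
Qed.

Lemma wythoff_pair_stable (p q : position) :
  K (small_pile p) (large_pile p) -> move p q ->
  ~ K (small_pile q) (large_pile q).
Proof.
move=> Kp mv; case: mv Kp => [a b k hk|a b k hab hk _] /= Kp Kq.
  have [|ea eb] := wythoff_pair_share Kp Kq; last by lia.
  case: (leqP a b) => hab; case: (leqP (a - k) b) => hab'.
  + by apply: Or44; lia.
  + by lia.
  + by apply: Or42; lia.
  + by apply: Or41; lia.
move: Kp Kq; rewrite !minnE !maxnE.
case=> [|[n [en1 en2]]]; first by lia.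
(* The pair [(0, 1)] has the same difference as [(3, 4)], but [k < a] leaves both piles nonempty. *)
case=> [|[m [em1 em2]]]; first by lia.
have enm : n = m by lia.
by subst m; lia.
Qed.

Lemma wythoff_pair_nonterminal (p : position) :
  K (small_pile p) (large_pile p) -> ~ terminal p.
Proof.
move=> Kp; rewrite (pos_sorted p) posC => ter.
apply: (ter (pos (large_pile p - 1) (small_pile p))); apply: move_one.
by case: Kp => [[_ ->]|[n [_ ->]]]; lia.
Qed.

Lemma move_large (a b c : nat) : c < b -> move (pos a b) (pos a c).
Proof.
move=> lt_cb; rewrite (posC a b) (posC a c) -(subKn (ltnW lt_cb)).
by apply: move_one; lia.
Qed.

Lemma wythoff_pair_absorbing (p : position) :
  ~ K (small_pile p) (large_pile p) -> ~ terminal p ->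
  exists2 q, move p q & K (small_pile q) (large_pile q).
Proof.
case: p => a b hab /=.
have -> : Position hab = pos a b := pos_sorted (Position hab).
have in_K c d : c <= d -> K c d -> K (minn c d) (maxn c d).
  by move=> /[dup] /minn_idPl -> /maxn_idPr ->.
move=> nK nter; case: (ltnP a 2) => ha.
  have K01 : K 0 1 by left.
  case: a hab nK nter ha => [|[|//]] hab nK nter _.
    case: b hab nK nter => [_ _ nter|[_ /(_ K01)//|b _ _ _]].
      case: nter => q mv; have := move_tokens mv.
      by rewrite tokens_pos.
    by exists (pos 0 1); [exact: move_large|apply: in_K].
  by exists (pos 1 0); [exact: move_large|rewrite /= minnC maxnC; apply: in_K].
have [n [an|an]] := wythoff_cover R (a - 2).
  have Kn : K (A n + 2) (A n + n + 2) by right; exists n.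
  have {an} ea : a = A n + 2 by lia.
  have len := leq_wythoff R n.
  case: (ltngtP b (A n + n + 2)) => hb.
  - have lt_dn : b - a < n by lia.
    have ltA := wythoff_mono R lt_dn; have leA := leq_wythoff R (b - a).
    have ratio1 c d : 0 < c <= d -> d < c + c -> d %/ c = 1.
      move=> /andP[c_gt0 le_cd] lt_d.
      by rewrite -(subnK le_cd) divnDr // divnn c_gt0 divn_small //; lia.
    (* With [d = b - a], the smaller pile goes from [A n + 2] to [A d + 2]. Both exceed [d], as
       [d < n <= A n] and [d <= A d], so [ratio1] applies before and after. *)
    exists (pos (a - (A n - A (b - a))) (b - (A n - A (b - a)))).
      apply: move_both; [lia|lia|].
      by rewrite !ratio1; lia.
    apply: in_K; first by lia.
    by right; exists (b - a); split; lia.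
  - exists (pos a (A n + n + 2)); first by apply: move_large.
    by apply: in_K; rewrite ea; [lia|].
  - by case: nK; rewrite hb ea.
(* For [n > 0] the target [A n + 2] is below [a], hence below [b]; for [n = 0] it equals [a], and
   [b = 2] must be excluded. *)
case: (posnP n) => [n0|n_gt0].
  have ea : a = 2 by move: an; rewrite n0 wythoff0; lia.
  have K22 : K 2 2 by right; exists 0; rewrite wythoff0.
  case: (ltngtP b 2) => hb; first by lia.
    by exists (pos a 2); [apply: move_large|rewrite ea; apply: in_K].
  by case: nK; rewrite ea hb.
exists (pos a (A n + 2)); first by apply: move_large; lia.
rewrite posC; apply: in_K; first by lia.
by right; exists n; split; lia.
Qed.

End Game.

Local Open Scope classical_set_scope.
Local Open Scope ring_scope.

Theorem theorem16 (R : realType) (a b : nat) (hab : (a <= b)%N) :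
  misere_P_position (pos a b) <->
  ([set (0, 1)] `|`
   [set (Num.floor (golden_ratio R * n%:~R) + 2,
         Num.floor (golden_ratio R ^+ 2 * n%:~R) + 2)
      | n in [set n : int | 0 <= n]]) (a%:Z, b%:Z).
Proof.
have kernelP := misere_P_position_kernel (@wythoff_pair_nonterminal R)
  (@wythoff_pair_stable R) (@wythoff_pair_absorbing R).
rewrite kernelP /= (minn_idPl hab) (maxn_idPr hab).
split=> [[[-> ->]|[n [-> ->]]]|[[ea eb]|[n]]].
- by left.
- by right; exists n%:Z => //; rewrite -pmulrn floor_golden floor_golden_sqr.
- by left; lia.
case: n => // n _; rewrite -pmulrn floor_golden floor_golden_sqr => -[ea eb].
by right; exists n; lia.
Qed.
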